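(* Let $n>3$ and $k\ge 0$ be integers. Then $\operatorname{Aut}(\operatorname{Inf}^k(K_n))\cong S_n$ and $\operatorname{fix}(\operatorname{Inf}^k(K_n))=\left\lceil\frac{n-1}{k+1}\right\rceil$.
   Context: Graphs are finite, undirected and simple. $K_n$ is the complete graph on $n$ vertices and $S_n$ is the symmetric group on $n$ letters. The inflation $\operatorname{Inf}(G)$ of a graph $G$ is the graph with one vertex for each ordered pair $(v,e)$ where $v$ is a vertex of $G$, $e$ is an edge of $G$, and $v$ and $e$ are incident; two distinct vertices $(v_1,e_1)$ and $(v_2,e_2)$ are adjacent if and only if $v_1=v_2$ or $e_1=e_2$. $\operatorname{Inf}^k(G)$ denotes the $k$-fold iterated inflation, with $\operatorname{Inf}^0(G)=G$. A set $S\subseteq V(G)$ is a fixing set of $G$ if the only automorphism of $G$ fixing every vertex of $S$ is the identity; the fixing number $\operatorname{fix}(G)$ is the smallest cardinality of a fixing set of $G$. *)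

(* Defs.v *)
From HB Require Import structures.
From mathcomp Require Import all_boot all_order all_fingroup all_algebra.
Set Implicit Arguments.
Unset Strict Implicit.
Unset Printing Implicit Defensive.

Record sgraph := SGraph {
  vertex :> finType;
  adj : rel vertex;
  adj_sym : symmetric adj;
  adj_irrefl : irreflexive adj }.

Section Complete.
Variable n : nat.

Definition complete_adj : rel 'I_n := fun i j => i != j.

Lemma complete_adj_sym : symmetric complete_adj.
Proof. by move=> i j; rewrite /complete_adj eq_sym. Qed.

Lemma complete_adj_irrefl : irreflexive complete_adj.
Proof. by move=> i; rewrite /complete_adj eqxx. Qed.

Definition complete : sgraph := SGraph complete_adj_sym complete_adj_irrefl.

End Complete.

Section Inflation.
Variable G : sgraph.

Definition edges : {set {set G}} :=
  [set [set p.1; p.2] | p : G * G & adj p.1 p.2].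

Definition flag : finType :=
  {p : G * {set G} | (p.2 \in edges) && (p.1 \in p.2)}.

Definition inf_adj : rel flag := fun a b =>
  (a != b) &&
  (((val a).1 == (val b).1) || ((val a).2 == (val b).2)).

Lemma inf_adj_sym : symmetric inf_adj.
Proof.
move=> a b; rewrite /inf_adj (eq_sym a) (eq_sym (val a).1).
by rewrite (eq_sym (val a).2).
Qed.

Lemma inf_adj_irrefl : irreflexive inf_adj.
Proof. by move=> a; rewrite /inf_adj eqxx. Qed.

Definition inflation : sgraph := SGraph inf_adj_sym inf_adj_irrefl.

End Inflation.

Definition iter_inflation (k : nat) (G : sgraph) : sgraph :=
  iter k inflation G.

Section Automorphisms.
Variable G : sgraph.

Definition graph_aut : {set {perm G}} :=
  [set s : {perm G} | [forall x, forall y, adj (s x) (s y) == adj x y]].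

Lemma graph_aut_group_set : group_set graph_aut.
Proof.
apply/group_setP; split.
  by rewrite inE; apply/'forall_forallP => x y; rewrite !perm1.
move=> s t; rewrite !inE => /'forall_'forall_eqP hs /'forall_'forall_eqP ht.
by apply/'forall_'forall_eqP => x y; rewrite !permM ht hs.
Qed.

Canonical graph_aut_group := Group graph_aut_group_set.

Definition fixing_set (S : {set G}) : bool :=
  [forall s in graph_aut, [forall x in S, s x == x] ==> (s == 1%g)].

(* The whole vertex set is a fixing set (fixing_setT), so the minimum is
   taken over a nonempty family. *)
Definition fixing_number : nat :=
  #|[arg min_(S < [set: G] | fixing_set S) #|S|]|.

Lemma fixing_setT : fixing_set [set: G].
Proof.
apply/forall_inP => s _; apply/implyP => /forall_inP fs.
by apply/eqP/permP => x; rewrite perm1; apply/eqP/fs; rewrite inE.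
Qed.

End Automorphisms.

(* Main.v *)
(** A vertex of [Inf(G)] is a dart of [G].  In a graph of minimum degree at
    least 3, an automorphism of [Inf(G)] preserves the cliques of darts with a
    common source, since their edges are those lying in triangles; hence it
    descends to [G], and [Aut(Inf(G)) = Aut(G)].

    The dart from [v] to [w] is fixed exactly when [v] and [w] are.  Inductively
    the stabilizer in [S_n] of a vertex of [Inf^k(K_n)] contains the pointwise
    stabilizer of some [k + 1] points, and any [k + 1] points are fixed by the
    stabilizer of some vertex.  Only the identity of [S_n] fixes [n - 1] given
    points, and a transposition fixes any [n - 2], so a fixing set of at most
    [m] vertices exists if and only if [m * (k + 1) >= n - 1]. *)
Require Import Defs.
From HB Require Import structures.
From mathcomp Require Import all_boot all_order all_fingroup all_algebra.
From mathcomp Require Import zify.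

Set Implicit Arguments.
Unset Strict Implicit.
Unset Printing Implicit Defensive.

Import Order.TTheory GRing.Theory Num.Theory.
Import GroupScope.
Local Open Scope nat_scope.

(* Minimum degree at least [3], phrased without cardinals. *)
Definition escapes_pairs (G : sgraph) : Prop :=
  forall v a b : G, exists w, [/\ adj v w, w != a & w != b].

(** * Darts of a graph and the automorphisms of its inflation *)

Section Flags.
Variable G : sgraph.
Implicit Types (v w : G) (x y z : inflation G).

Lemma adj_neq v w : adj v w -> v != w.
Proof. by apply: contraTneq => ->; rewrite adj_irrefl. Qed.

Lemma set2_inj v : injective (fun w => [set v; w]).
Proof.
move=> w w' e.
have /set2P[e1|//] : w \in [set v; w'] by rewrite -e set22.
have /set2P[e2|//] : w' \in [set v; w] by rewrite e set22.
by rewrite e1 e2.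
Qed.

Definition src x : G := (val x).1.
(** The default [src x] is never taken: the edge of a flag always joins its vertex to a neighbour,
    see [flag_split]. *)
Definition tgt x : G :=
  odflt (src x) [pick w | adj (src x) w && ((val x).2 == [set src x; w])].

Lemma flag_split x :
  adj (src x) (tgt x) /\ val x = (src x, [set src x; tgt x]).
Proof.
rewrite /tgt; case: pickP => [w /andP[vw /eqP e]|no] /=.
  by split=> //; rewrite -e; apply: surjective_pairing.
move: (valP x) => /andP[/imsetP[[a b] ab e]]; rewrite inE /= in ab.
rewrite e !inE /= => /orP[] /eqP h.
  by move: (no b); rewrite /src h ab e /= eqxx.
by move: (no a); rewrite /src h adj_sym ab e setUC /= eqxx.
Qed.

Lemma adj_src_tgt x : adj (src x) (tgt x).
Proof. by case: (flag_split x). Qed.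

Lemma flag_ext x y : src x = src y -> tgt x = tgt y -> x = y.
Proof.
by move=> es et; apply: val_inj; case: (flag_split x) => _ ->;
   case: (flag_split y) => _ ->; rewrite es et.
Qed.

Lemma dart v w : adj v w -> exists x, src x = v /\ tgt x = w.
Proof.
move=> vw.
have p : ([set v; w] \in edges G) && (v \in [set v; w]).
  by rewrite !inE eqxx andbT; apply/imsetP; exists (v, w); rewrite ?inE.
pose x : inflation G := Sub (v, [set v; w]) p.
have vx : val x = (v, [set v; w]) by rewrite /x SubK.
have sx : src x = v by rewrite /src vx.
exists x; split=> //; case: (flag_split x) => _; rewrite vx sx => -[] e.
by apply/esym/(@set2_inj v).
Qed.

Lemma adj_inf x y :
  adj x y <->
  x <> y /\ (src x = src y \/ (src x = tgt y /\ tgt x = src y)).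
Proof.
rewrite {1}/adj /= /inf_adj.
have [ax ex] := flag_split x; have [ay ey] := flag_split y; rewrite ex ey /=.
split=> [/andP[/eqP ne /orP[/eqP h|/eqP/setP h]]|[/eqP-> /=]].
- by split=> //; left.
- split=> //; have [e|ns] := eqVneq (src x) (src y); [by left|right].
  have := h (src x); have := h (src y).
  rewrite !inE !eqxx /= (negPf ns) eq_sym (negPf ns) /=.
  by move=> /eqP-> /esym/eqP.
- by case=> [->|[-> ->]]; rewrite ?eqxx // setUC eqxx orbT.
Qed.

Lemma opp_flag x : exists y, [/\ src y = tgt x, tgt y = src x & adj x y].
Proof.
have ax := adj_src_tgt x.
have [|y [sy ty]] := @dart (tgt x) (src x); first by rewrite adj_sym.
exists y; split=> //; apply/adj_inf; split; last by right.
by move=> e; move: (adj_neq ax); rewrite -sy e eqxx.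
Qed.

Definition lifts (s : {perm G}) (t : {perm inflation G}) : Prop :=
  forall x, src (t x) = s (src x) /\ tgt (t x) = s (tgt x).

Lemma autE (H : sgraph) (s : {perm H}) :
  s \in graph_aut H -> forall a b, adj (s a) (s b) = adj a b.
Proof. by rewrite inE => /'forall_'forall_eqP. Qed.

Lemma autI (H : sgraph) (s : {perm H}) :
  (forall a b, adj a b -> adj (s a) (s b)) ->
  (forall a b, adj (s a) (s b) -> adj a b) -> s \in graph_aut H.
Proof.
move=> h1 h2; rewrite inE; apply/'forall_'forall_eqP => a b.
by apply/idP/idP; [exact: h2|exact: h1].
Qed.

Lemma aut_lift (s : {perm G}) : s \in graph_aut G ->
  exists2 t : {perm inflation G}, t \in graph_aut (inflation G) & lifts s t.
Proof.
move=> sA.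
have: forall x, exists y, src y = s (src x) /\ tgt y = s (tgt x).
  by move=> x; apply: dart; rewrite autE ?adj_src_tgt.
case/fin_all_exists => t ht.
have tI : injective t.
  move=> x y e; have [a b] := ht x; have [c d] := ht y.
  by apply: flag_ext; apply: (@perm_inj _ s); rewrite -?a -?b e.
have sI := @perm_inj _ s.
exists (perm tI); last by move=> x; rewrite permE.
by apply: autI => x y /adj_inf[ne h]; apply/adj_inf; rewrite !permE in ne h *;
  (split; first by move=> e; apply: ne; rewrite ?e // (tI _ _ e));
  move: h; rewrite !(proj1 (ht _)) !(proj2 (ht _)) => -[e|[e e']];
  [left|right|left|right]; rewrite ?(sI _ _ e) ?(sI _ _ e') ?e ?e'.
Qed.

Hypothesis deg3 : escapes_pairs G.

(* Edges of [inflation G] between two flags on the same edge of [G] lie in no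
   triangle, whereas those inside the clique of a vertex of degree at least
   [3] do. *)
Lemma same_srcP x y : x <> y ->
  (src x = src y <-> adj x y /\ exists z, adj x z /\ adj y z).
Proof.
move=> ne; split=> [e|[/adj_inf[_ [//|[e1 e2]]]]].
  have [w [vw /eqP n1 /eqP n2]] := deg3 (src x) (tgt x) (tgt y).
  have [z [sz tz]] := dart vw.
  split; first by apply/adj_inf; split=> //; left.
  exists z; split; apply/adj_inf; split; rewrite ?sz; auto => ez.
    by apply: n1; rewrite -tz -ez.
  by apply: n2; rewrite -tz -ez.
case=> z [/adj_inf[nx [xz|[xz xz']]] /adj_inf[ny [yz|[yz yz']]]].
- by rewrite xz yz.
- by case: nx; apply: flag_ext; rewrite ?e1 ?e2.
- by case: ny; apply: flag_ext; congruence.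
- by case: ny; apply: flag_ext; congruence.
Qed.

Lemma aut_same_src (t : {perm inflation G}) x y :
  t \in graph_aut (inflation G) -> src x = src y -> src (t x) = src (t y).
Proof.
move=> tA e; have [->//|/eqP ne] := eqVneq x y.
apply/same_srcP; first by move/perm_inj.
have [a [z [b c]]] := proj1 (same_srcP ne) e.
by rewrite autE //; split=> //; exists (t z); rewrite !autE.
Qed.

(** The vertex map is read off from one chosen dart [fl v] out of each [v]; it is injective because
    [t^-1] preserves common sources too. *)
Lemma aut_descend (t : {perm inflation G}) :
  t \in graph_aut (inflation G) -> exists2 s, s \in graph_aut G & lifts s t.
Proof.
move=> tA; have tV : t^-1 \in graph_aut (inflation G) by rewrite groupV.
have: forall v, exists x, src x = v.
  move=> v; have [w [vw _ _]] := deg3 v v v.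
  by have [x [sx _]] := dart vw; exists x.
case/fin_all_exists => fl hfl.
have srct x y : src (t x) = src (t y) -> src x = src y.
  by move/(aut_same_src tV); rewrite !permK.
pose s v := src (t (fl v)).
have sE x : src (t x) = s (src x) by apply: aut_same_src; rewrite ?hfl.
have sI : injective s by move=> v w /srct; rewrite !hfl.
have sL : lifts (perm sI) t.
  move=> x; rewrite !permE; split; first exact: sE.
  (* The reversal [y] of [x] has another source, so [t y] can be adjacent to [t x] only as its
     reversal. *)
  have [y [sy ty xy]] := opp_flag x.
  have := xy; rewrite -(autE tA) => /adj_inf[_ [/srct e|[_ ->]]].
    by have := adj_neq (adj_src_tgt x); rewrite -sy e eqxx.
  by rewrite sE sy.
exists (perm sI) => //; apply: autI => v w vw.
  have [x [<- <-]] := dart vw.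
  by have [<- <-] := sL x; apply: adj_src_tgt.
have [y [sy ty]] := dart vw.
have [] := sL (t^-1 y); rewrite permKV sy ty => /perm_inj-> /perm_inj->.
exact: adj_src_tgt.
Qed.

(** Besides its reversal, a dart is adjacent to at least two other darts with its source; of three
    distinct neighbours one avoids [a] and [b]. *)
Lemma escapes_pairs_inflation : escapes_pairs (inflation G).
Proof.
move=> x a b.
have [y [sy ty xy]] := opp_flag x.
have [w1 [a1 n1 _]] := deg3 (src x) (tgt x) (tgt x).
have [w2 [a2 n2 n3]] := deg3 (src x) (tgt x) w1.
have [z1 [s1 t1]] := dart a1; have [z2 [s2 t2]] := dart a2.
have xz1 : adj x z1.
  apply/adj_inf; split; last by left.
  by move=> e; rewrite e t1 eqxx in n1.
have xz2 : adj x z2.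
  apply/adj_inf; split; last by left.
  by move=> e; rewrite e t2 eqxx in n2.
have sn := adj_neq (adj_src_tgt x).
have yz1 : y != z1.
  by apply: contraNneq sn => e; rewrite -sy e s1.
have yz2 : y != z2.
  by apply: contraNneq sn => e; rewrite -sy e s2.
have z12 : z1 != z2.
  by apply: contraNneq n3 => e; rewrite -t1 e t2.
have [ya|ya] := eqVneq y a.
  rewrite -ya; have [zb|zb] := eqVneq z1 b.
    by exists z2; rewrite -zb !(eq_sym z2).
  by exists z1; rewrite (eq_sym z1 y).
have [yb|yb] := eqVneq y b; last by exists y.
rewrite -yb; have [za|za] := eqVneq z1 a.
  by exists z2; rewrite -za !(eq_sym z2).
by exists z1; rewrite (eq_sym z1 y).
Qed.

End Flags.

(** * One group acting through successive inflations *)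

Lemma lifts_inj (G : sgraph) (s : {perm G}) t t' :
  lifts s t -> lifts s t' -> t = t'.
Proof.
move=> h h'; apply/permP => x; have [a b] := h x; have [c d] := h' x.
by apply: flag_ext; rewrite ?a ?b.
Qed.

Lemma lifts_fix (G : sgraph) (s : {perm G}) t (x : inflation G) :
  lifts s t -> t x = x <-> s (src x) = src x /\ s (tgt x) = tgt x.
Proof.
move=> h; have [a b] := h x; split=> [e|[e1 e2]].
  by rewrite -a -b e.
by apply: flag_ext; rewrite ?a ?b.
Qed.

(** An isomorphism onto the automorphism group, kept as a plain function so that the same [gT]
    serves at every stage. *)
Definition aut_rep (gT : finGroupType) (G : sgraph) (rho : gT -> {perm G}) :=
  [/\ {morph rho : g h / (g * h)%g}, injective rho
    & forall t, t \in graph_aut G <-> exists g, rho g = t].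

Lemma aut_rep_inflation (gT : finGroupType) (G : sgraph)
    (rho : gT -> {perm G}) :
  escapes_pairs G -> aut_rep rho ->
  exists2 rho' : gT -> {perm inflation G},
    aut_rep rho' & forall g, lifts (rho g) (rho' g).
Proof.
move=> deg3 [rM rI rA].
have rhoA g : rho g \in graph_aut G by apply/rA; exists g.
have: forall g, exists t : {perm inflation G},
    t \in graph_aut (inflation G) /\ lifts (rho g) t.
  by move=> g; have [t ? ?] := aut_lift (rhoA g); exists t.
case/fin_all_exists => rho' /all_and2[r'A r'L].
exists rho' => //; split=> [g h|g h e|t].
- apply: (lifts_inj (r'L _)) => x; rewrite rM !permM.
  by have [a b] := r'L h (rho' g x); have [c d] := r'L g x; rewrite a b c d.
- apply/rI/permP => v; have [w [vw _ _]] := deg3 v v v.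
  have [x [<- _]] := dart vw.
  by have [<- _] := r'L g x; have [<- _] := r'L h x; rewrite e.
- split=> [tA|[g <-]]; last exact: r'A.
  have [s sA sL] := aut_descend deg3 tA; have [g e] := proj1 (rA s) sA.
  by exists g; apply: lifts_inj sL; rewrite -e.
Qed.

Lemma aut_rep_isog (gT : finGroupType) (G : sgraph) (rho : gT -> {perm G}) :
  aut_rep rho -> graph_aut G \isog [set: gT].
Proof.
case=> rM rI rA; rewrite isog_sym.
pose f := @Morphism _ _ [set: gT] rho (in2W rM).
apply: (isom_isog f) => //; apply/isomP; split.
  by apply/injmP => g h _ _; apply: rI.
apply/setP => t; apply/morphimP/idP => [[g _ _ ->]|/rA[g <-]].
  by apply/rA; exists g.
by exists g; rewrite ?inE.
Qed.

Lemma aut_rep1 (gT : finGroupType) (G : sgraph) (rho : gT -> {perm G}) :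
  aut_rep rho -> rho 1%g = 1%g.
Proof. by case=> rM _ _; apply: (mulgI (rho 1%g)); rewrite -rM !mulg1. Qed.

(** * Points of ['I_n] controlled by a vertex *)

Section Supports.
Variable n : nat.

Definition small_supports (k : nat) (G : sgraph)
    (rho : {perm 'I_n} -> {perm G}) : Prop :=
  exists supp : G -> {set 'I_n},
    [/\ forall x, #|supp x| <= k.+1,
        forall x y, adj x y -> #|supp y :\: supp x| <= 1
      & forall (s : {perm 'I_n}) x, {in supp x, forall i, s i = i} -> rho s x = x].

(* The clause on neighbours is what allows the list to grow by one point at
   each inflation: the flag [(x, xy)] is fixed iff [x] and [y] are. *)
Definition separating (k : nat) (G : sgraph)
    (rho : {perm 'I_n} -> {perm G}) : Prop :=
  forall l : seq 'I_n, size l = k.+1 -> exists x : G,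
    (forall s, rho s x = x -> {in l, forall i, s i = i}) /\
    forall b, exists2 y, adj x y
      & forall s, rho s x = x -> rho s y = y -> s b = b.

Section Step.
Variables (k : nat) (G : sgraph) (rho : {perm 'I_n} -> {perm G}).
Variable rho' : {perm 'I_n} -> {perm inflation G}.
Hypothesis rhoL : forall s, lifts (rho s) (rho' s).

(** A flag is supported by its two ends, whose supports differ by at most one point. Flags with a
    common source differ only through a target, and opposite flags have equal supports. *)
Lemma small_supports_inflation :
  small_supports k rho -> small_supports k.+1 rho'.
Proof.
case=> supp [sk sd sf].
exists (fun x => supp (src x) :|: supp (tgt x)); split=> [x|x y|s x h].
- have d := sd _ _ (adj_src_tgt x); rewrite cardsD setIC in d.
  by rewrite cardsU; have := sk (src x); lia.
- case/adj_inf=> _ [e|[e1 e2]] /=.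
    rewrite e; apply: leq_trans _ (sd _ _ (adj_src_tgt y)).
    apply/subset_leq_card/subsetP => i; rewrite !inE.
    by case: (i \in supp (src y)) (i \in supp (tgt x)) => [] [].
  by rewrite e1 e2 setUC setDv cards0.
- apply/(lifts_fix _ (rhoL s)); split; apply: sf => i hi; apply: h;
  by rewrite inE hi ?orbT.
Qed.

(** Take [v] for the tail of the list and a neighbour [w] that pins down the head: the dart from [v]
    to [w] serves. For a further point [c], turn to the dart from [v] to the neighbour [u] given by
    [c], or to the reversal when [u = w]. *)
Lemma separating_inflation : separating k rho -> separating k.+1 rho'.
Proof.
move=> sep [|b l] //= [/sep[v [vf vn]]].
have [w vw wf] := vn b; have [x [sx tx]] := dart vw.
have fx s : rho' s x = x -> rho s v = v /\ rho s w = w.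
  by move/(lifts_fix _ (rhoL s)); rewrite sx tx.
exists x; split=> [s /fx[fv fw] i|c].
  by rewrite inE => /predU1P[->|/vf]; [exact: wf|exact].
have [u vu uf] := vn c; have [e|ne] := eqVneq w u.
  have [y [_ _ xy]] := opp_flag x; exists y => // s /fx[fv fw] _.
  by apply: uf; rewrite -?e.
have [y [sy ty]] := dart vu; exists y.
  apply/adj_inf; split; last by left; rewrite sx.
  by move=> e; rewrite -tx e ty eqxx in ne.
move=> s _ /(lifts_fix _ (rhoL s)); rewrite sy ty => -[fv fu]; exact: uf.
Qed.

End Step.

(** * Bounds on the size of a fixing set *)

Lemma fixing_lower_bound (k : nat) (G : sgraph)
    (rho : {perm 'I_n} -> {perm G}) (S : {set G}) :
  aut_rep rho -> small_supports k rho -> fixing_set S ->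
  n.-1 <= #|S| * k.+1.
Proof.
move=> rep [supp [sk _ sf]] /forall_inP fS.
pose U := \bigcup_(x in S) supp x.
have cU : #|U| <= #|S| * k.+1.
  rewrite -sum_nat_const /U.
  elim/big_rec2: _ => [|x m A xS IH]; first by rewrite cards0.
  exact: leq_trans (leq_card_setU _ _) (leq_add (sk x) IH).
have [rM rI rA] := rep; apply: leq_trans cU; rewrite leqNgt; apply/negP => lt.
(* Two points outside all supports: their transposition would fix [S]. *)
have: 1 < #|~: U| by rewrite cardsCs setCK card_ord; lia.
case/card_gt1P => p [q]; rewrite !inE => -[pU qU pq].
have fx i : i \in U -> tperm p q i = i.
  by move=> iU; apply: tpermD; [apply: contraNneq pU|apply: contraNneq qU] => ->.
have /fS/implyP fS' : rho (tperm p q) \in graph_aut G.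
  by apply/rA; exists (tperm p q).
have /eqP : rho (tperm p q) == 1%g.
  apply: fS'; apply/forall_inP => x xS; apply/eqP/sf => i ix.
  by apply: fx; apply/bigcupP; exists x.
rewrite -(aut_rep1 rep) => /rI/permP/(_ p); rewrite tpermL perm1 => e.
by rewrite e eqxx in pq.
Qed.

Lemma fixing_upper_bound (k M : nat) (G : sgraph)
    (rho : {perm 'I_n} -> {perm G}) (i0 : 'I_n) :
  aut_rep rho -> separating k rho -> n.-1 <= M * k.+1 ->
  exists2 S : {set G}, fixing_set S & #|S| <= M.
Proof.
move=> rep sep le; have [rM rI rA] := rep.
(* Consecutive blocks of [k.+1] points, padded by [i0] past the end; together they contain every
   point below [n.-1]. *)
pose l (i : 'I_M) := [seq nth i0 (enum 'I_n) (i * k.+1 + j) | j <- iota 0 k.+1].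
have: forall i, exists x,
    forall s, rho s x = x -> {in l i, forall p, s p = p}.
  move=> i; have [|x [hx _]] := sep (l i); last by exists x.
  by rewrite size_map size_iota.
case/fin_all_exists => f hf.
exists [set f i | i : 'I_M]; last first.
  by apply: leq_trans (leq_imset_card _ _) _; rewrite card_ord.
apply/forall_inP => _ /rA[g <-]; apply/implyP => /forall_inP fx.
have gp (p : 'I_n) : p < n.-1 -> g p = p.
  move=> pn; have iM : p %/ k.+1 < M by rewrite ltn_divLR //; lia.
  apply: (hf (Ordinal iM)); first by apply/eqP/fx/imset_f; rewrite inE.
  apply/mapP; exists (p %% k.+1); first by rewrite mem_iota ltn_pmod.
  by rewrite /= -divn_eq nth_ord_enum.
suff -> : g = 1%g by rewrite (aut_rep1 rep).
apply/permP => p; rewrite perm1.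
(* Only the last point remains, and injectivity of [g] leaves it no other image. *)
have [/gp//|pn] := ltnP p n.-1.
have [/gp/perm_inj//|gn] := ltnP (g p) n.-1.
by apply: val_inj => /=; have := ltn_ord p; have := ltn_ord (g p); lia.
Qed.

Lemma fixing_number_ceil (k : nat) (G : sgraph)
    (rho : {perm 'I_n} -> {perm G}) :
  1 < n -> aut_rep rho -> small_supports k rho -> separating k rho ->
  (fixing_number G)%:Z%R = Num.ceil ((n%:R - 1) / (k%:R + 1) : rat)%R.
Proof.
move=> n1 rep sup sep; rewrite /fixing_number.
case: arg_minnP => [|S fS minS]; first exact: fixing_setT.
have lb := fixing_lower_bound rep sup fS.
have S0 : 0 < #|S| by rewrite lt0n; apply: contraTneq lb => ->; lia.
(* Otherwise [#|S|.-1] vertices would suffice, against minimality, since [#|S|] is positive.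
   Together with [lb] this brackets the quotient as the ceiling requires. *)
have ub : #|S|.-1 * k.+1 < n.-1.
  rewrite ltnNge; apply/negP => /(fixing_upper_bound (Ordinal n1) rep sep).
  by case=> T /minS; lia.
apply/esym/ceil_def.
have -> : ((#|S| : int) - 1)%R = #|S|.-1%:Z%R by lia.
have -> : (n%:R - 1 = n.-1%:R :> rat)%R by rewrite -subn1 natrB // ltnW.
rewrite natr1 !pmulrn.
rewrite ltr_pdivlMr ?ler_pdivrMr ?ltr0n // -!pmulrn -!natrM ltr_nat ler_nat.
by rewrite ub lb.
Qed.

End Supports.

(** * Induction from the complete graph *)

Lemma iter_inflation_rep (n k : nat) : 3 < n ->
  escapes_pairs (iter_inflation k (complete n)) /\
  exists rho : {perm 'I_n} -> {perm iter_inflation k (complete n)},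
    [/\ aut_rep rho, small_supports k rho & separating k rho].
Proof.
move=> hn; elim: k => [|k [deg3 [rho [rep sup sep]]]].
  split=> [v a b|].
    (* At most three vertices are excluded, and [3 < n]. *)
    have: 0 < #|~: [set v; a; b]|.
      rewrite cardsCs setCK card_ord subn_gt0.
      apply: leq_ltn_trans hn; apply: leq_trans (leq_card_setU _ _) _.
      by rewrite cards1 cards2; case: (v != a).
    case/card_gt0P => w; rewrite !inE !negb_or -andbA => /and3P[wv wa wb].
    by exists w; split=> //; rewrite /adj /= /complete_adj eq_sym.
  exists id; split.
  - split=> // t; split=> [_|_]; first by exists t.
    apply: autI => a b; rewrite /adj /= /complete_adj (inj_eq perm_inj) //.
  - exists (fun i => [set i]); split=> [x|x y _|s x h].
    + by rewrite cards1.
    + by rewrite -(cards1 y) subset_leq_card ?subsetDl.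
    + by apply: h; rewrite inE.
  - move=> [|a [|? ?]] //= _; exists a; split=> [s e i|b].
      by rewrite inE => /eqP->.
    (* The neighbour is [b] itself; if [b = a], it is already fixed and any other vertex will do. *)
    have [e|ne] := eqVneq b a; last first.
      by exists b => //; rewrite /adj /= /complete_adj eq_sym.
    have: 0 < #|[set~ a]| by rewrite cardsC1 card_ord; lia.
    case/card_gt0P => c; rewrite !inE => ca.
    exists c; last by rewrite e.
    by rewrite /adj /= /complete_adj eq_sym.
have [rho' rep' rhoL] := aut_rep_inflation deg3 rep.
split; first exact: escapes_pairs_inflation.
exists rho'; split=> //.
- exact: (small_supports_inflation rhoL).
- exact: (separating_inflation rhoL).
Qed.

Theorem theorem16 (n k : nat) (hn : (3 < n)%N) :
  (graph_aut (iter_inflation k (complete n)) \isog [set: 'S_n])%g /\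
  (fixing_number (iter_inflation k (complete n)))%:Z%R
    = Num.ceil ((n%:R - 1) / (k%:R + 1) : rat)%R.
Proof.
have [_ [rho [rep sup sep]]] := iter_inflation_rep k hn.
split; first exact: aut_rep_isog rep.
by apply: fixing_number_ceil rep sup sep; lia.
Qed.
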